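(* Let $(a_n)$ be an arithmetic sequence and let $(d_n)$ be the associated non-arithmetic sequence. If $(a_n)$ is strongly non dli, then $t^{s}_{(d_n)}(\mathbb{T})$ is countable.
   Context: $\mathbb{N}=\{1,2,3,\dots\}$ and $\mathbb{T}=\mathbb{R}/\mathbb{Z}$ is the circle group. For $A\subseteq\mathbb{N}$, $\overline{d}(A)=\limsup_{n\to\infty}\frac{|A\cap[0,n-1]|}{n}$ is the upper natural density, $\underline{d}(A)$ is the corresponding liminf, and $d(A)$ denotes the common value when they agree. An arithmetic sequence is a sequence of positive integers $(a_n)_{n\ge 0}$ with $1=a_0<a_1<a_2<\dots$ and $a_n\mid a_{n+1}$ for every $n$. Its ratios are $b_n=a_n/a_{n-1}$ for $n\ge1$ (so $b_1=a_1$ and $b_n\ge 2$). The associated sequence $(d_n)_{n\ge1}$ is the increasing enumeration of the set $\{r a_k : k\ge 0,\ 1\le r<b_{k+1}\}$. Write $a_k=d_{n_k}$; thus $n_0=1$, $n_{k+1}-n_k=b_{k+1}-1$, and $d_{n_k+r-1}=ra_k$ for $1\le r\le b_{k+1}-1$. The lifting function $L:\mathcal{P}(\mathbb{N})\to\mathcal{P}(\mathbb{N})$ is $L(A)=\bigcup_{k\in A}[n_{k-1},n_k-1]$ (integer intervals). $(a_n)$ is strongly non dli (strongly non density lifting invariant) if $\overline{d}(L(A))>0$ for every infinite $A\subseteq\mathbb{N}$. For a sequence of integers $(u_n)$, $t^s_{(u_n)}(\mathbb{T})=\{x\in\mathbb{T}: u_nx\to 0\text{ statistically in }\mathbb{T}\}$,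 meaning that for every $\varepsilon>0$, $d(\{n\in\mathbb{N}:\|u_nx\|\ge\varepsilon\})=0$, with $\|y\|$ the distance from $y$ to the nearest integer. *)

(* Defs.v *)
From HB Require Import structures.
From mathcomp Require Import all_boot all_order all_algebra.
From mathcomp Require Import all_classical all_reals all_analysis.
Set Implicit Arguments.
Unset Strict Implicit.
Unset Printing Implicit Defensive.
Import Order.TTheory GRing.Theory Num.Theory.
Import numFieldNormedType.Exports.
Local Open Scope classical_set_scope.
Local Open Scope ring_scope.
Local Open Scope quotient_scope.

(* Subsets of {1, 2, 3, ...} are represented as sets A : set nat that do not
   contain 0, and 1-indexed sequences as functions on nat whose value at 0 is
   irrelevant. *)

Section Density.
Variable R : realType.
Implicit Types (A : set nat) (v : R).

Definition partial_density A (n : nat) : R :=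
  #|[pred i : 'I_n | val i \in A]|%:R / n%:R.

Definition upper_density A : R := limn_sup (partial_density A).

Definition lower_density A : R := limn_inf (partial_density A).

Definition has_density A v : Prop := upper_density A = v /\ lower_density A = v.

End Density.

Section Arithmetic.
Local Open Scope nat_scope.
Implicit Types (a : nat -> nat) (S A : set nat) (k m n r : nat).

Definition arithmetic_seq a : Prop :=
  [/\ a 0 = 1, forall n, (a n < a n.+1) & forall n, (a n %| a n.+1)].

(* Meaningful for n >= 1 only. *)
Definition ratio a n : nat := (a n %/ a n.-1).

Definition assoc_set a : set nat :=
  [set m | exists k r, (1 <= r < ratio a k.+1) /\ m = (r * a k)].

Definition next_elt S m : nat :=
  xget 0 [set s | [/\ S s, (m < s) & forall t, S t -> (m < t) -> (s <= t)]].

(* For n >= 1, the n-th positive element of S in increasing order. *)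
Definition enumeration S n : nat := iter n (next_elt S) 0.

Definition assoc_seq a : nat -> nat := enumeration (assoc_set a).

(* The index n_k >= 1 such that a_k = d_(n_k), for d := assoc_seq a. *)
Definition assoc_index a k : nat :=
  xget 0 [set n | (1 <= n) /\ assoc_seq a n = a k].

Definition lifting a A : set nat :=
  [set m | exists k, [/\ A k, (1 <= k) &
    (assoc_index a k.-1 <= m <= (assoc_index a k).-1)]].

Definition strongly_non_dli (R : realType) a : Prop :=
  forall A, A `<=` [set k | (1 <= k)] -> infinite_set A ->
    (0 < upper_density R (lifting a A))%R.

(* The next lemmas show that the default values of xget above are never used. *)

Lemma arithmetic_seq_gt a k : arithmetic_seq a -> (k < a k).
Proof.
case=> a0 ainc _; elim: k => [|k IHk]; first by rewrite a0.
exact: leq_ltn_trans IHk (ainc k).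
Qed.

Lemma ratioE a k : arithmetic_seq a -> a k.+1 = (ratio a k.+1 * a k).
Proof. by case=> _ _ adiv; rewrite /ratio /= divnK. Qed.

Lemma ratio_ge2 a k : arithmetic_seq a -> (2 <= ratio a k.+1).
Proof.
move=> ha; have [_ ainc _] := ha; have := ainc k.
rewrite (ratioE k ha); case: (ratio _ _) => [|[|//]]; first by rewrite mul0n.
by rewrite mul1n ltnn.
Qed.

Lemma assoc_set_a a k : arithmetic_seq a -> assoc_set a (a k).
Proof. by move=> ha; exists k, 1; rewrite mul1n (ratio_ge2 k ha). Qed.

Lemma next_eltE S m s : S s -> (m < s) ->
  (forall t, S t -> (m < t) -> (s <= t)) -> next_elt S m = s.
Proof.
move=> Ss ms smin; apply: xget_unique => // t [St mt tmin].
by apply/eqP; rewrite eqn_leq smin // tmin.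
Qed.

Lemma next_eltP a m : arithmetic_seq a ->
  [/\ assoc_set a (next_elt (assoc_set a) m), (m < next_elt (assoc_set a) m)
    & forall t, assoc_set a t -> (m < t) -> (next_elt (assoc_set a) m <= t)].
Proof.
move=> ha.
have ex : exists s, `[< assoc_set a s >] && (m < s).
  exists (a m); rewrite (arithmetic_seq_gt m ha) andbT.
  by apply/asboolP; apply: assoc_set_a.
have [s /andP[/asboolP Ss ms] smin] := ex_minnP ex.
have smin' t : assoc_set a t -> (m < t) -> (s <= t).
  by move=> St mt; apply: smin; rewrite mt andbT; apply/asboolP.
by rewrite (next_eltE Ss ms smin').
Qed.

Lemma assoc_seq_mono a n : arithmetic_seq a -> (assoc_seq a n < assoc_seq a n.+1).
Proof. by move=> ha; have [] := next_eltP (assoc_seq a n) ha. Qed.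

Lemma assoc_seq_range a : arithmetic_seq a ->
  assoc_seq a @` [set n | (1 <= n)] = assoc_set a.
Proof.
move=> ha; have [a0 ainc _] := ha; apply/seteqP; split=> [_ [[//|n] _ <-]|s Ss].
  by have [] := next_eltP (assoc_seq a n) ha.
have s_gt0 : (0 < s).
  case: Ss => k [r [/andP[r1 _] ->]]; rewrite muln_gt0 r1.
  exact: leq_ltn_trans (arithmetic_seq_gt k ha).
have ge_id n : (n <= assoc_seq a n).
  by elim: n => // n IHn; apply: leq_ltn_trans IHn (assoc_seq_mono n ha).
have : (s <= assoc_seq a s) by [].
elim: {2}s => [|n IHn]; first by rewrite leqNgt s_gt0.
have [/IHn //|lt_ns] := leqP s (assoc_seq a n).
move=> le_sn; exists n.+1 => //; apply/eqP; rewrite eqn_leq le_sn andbT.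
by have [_ _] := next_eltP (assoc_seq a n) ha; apply.
Qed.

Lemma assoc_indexE a n k : arithmetic_seq a -> (1 <= n) ->
  assoc_seq a n = a k -> assoc_index a k = n.
Proof.
move=> ha n1 dn; apply: xget_unique => // m [m1 dm].
have inc : {mono assoc_seq a : i j / (i <= j)}.
  by apply: leq_mono; apply: homo_ltn => [|i]; [exact: ltn_trans|exact: assoc_seq_mono].
by apply: (incn_inj inc); rewrite dm dn.
Qed.

Lemma assoc_indexP a k : arithmetic_seq a ->
  (1 <= assoc_index a k) /\ assoc_seq a (assoc_index a k) = a k.
Proof.
move=> ha; have := assoc_set_a k ha.
by rewrite -(assoc_seq_range ha) => -[n n1 dn]; rewrite (assoc_indexE ha n1 dn).
Qed.

End Arithmetic.

Section Circle.
Variable R : realType.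

(* The predicate Num.int, as an additive subgroup of R. *)
Definition int_subgroup : zmodClosed R :=
  GRing.ZmodClosed.clone R Num.int_num_subdef _.

Definition circle : Type := Quotient.quot int_subgroup.

HB.instance Definition _ := GRing.Zmodule.on circle.

HB.instance Definition _ := EqQuotient.on circle.

(* The distance from y to the nearest integer, computed on a representative. *)
Definition circle_norm (y : circle) : R :=
  inf [set `|repr y - m%:~R| | m in [set: int]].

Definition stat_cvg0 (x : nat -> circle) : Prop :=
  forall e : R, 0 < e ->
    has_density [set n | (1 <= n)%N /\ e <= circle_norm (x n)] (0 : R).

(* t^s_{(u_n)}(T) *)
Definition stat_char_subgroup (u : nat -> int) : set circle :=
  [set x | stat_cvg0 (fun n => x *~ u n)].

Lemma circle_norm_pi (r : R) : circle_norm (\pi_circle r) =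
  inf [set `|r - m%:~R| | m in [set: int]].
Proof.
have [k hk] : exists k : int, repr (\pi_circle r) = r + k%:~R.
  have /eqP : \pi_circle (repr (\pi_circle r)) = \pi_circle r by rewrite reprK.
  rewrite -Quotient.idealrBE => /intrP[k hk].
  by exists k; rewrite -hk addrC subrK.
rewrite /circle_norm hk; congr inf; apply/seteqP.
split=> _ [m _ <-]; [exists (m - k)|exists (m + k)] => //; congr `|_|.
  by rewrite intrB opprB addrCA addrA (addrC r).
by rewrite intrD opprD addrACA subrr addr0.
Qed.

End Circle.

Arguments stat_char_subgroup : clear implicits.

(* Main.v *)
(* Let x be in the subgroup and suppose that a_k x <> 0 for every k. If
   b_(k+1) ||a_k x|| < 1/2 then ||a_(k+1) x|| = b_(k+1) ||a_k x|| >= 2 ||a_k x||,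
   so b_(k+1) ||a_k x|| >= 1/2 for infinitely many k. For such k at least a quarter
   of the multiples r a_k x with 1 <= r < b_(k+1) have norm at least 1/16. Strong
   non density lifting invariance then makes the set of n with ||d_n x|| >= 1/16
   have positive upper density, a contradiction. Hence a_k x = 0 for some k, and
   only countably many x are torsion. *)

Require Import Defs.
From mathcomp Require Import all_boot all_order all_algebra.
From mathcomp Require Import all_classical all_reals all_analysis.
From mathcomp Require Import zify lra.
Set Implicit Arguments.
Unset Strict Implicit.
Unset Printing Implicit Defensive.
Import Order.TTheory GRing.Theory Num.Theory.
Local Open Scope classical_set_scope.
Local Open Scope ring_scope.
Local Open Scope quotient_scope.

(** * The norm on the circle *)

Section CircleNorm.
Variable R : realType.
Implicit Types (r s : R) (x y : circle R).

Lemma circle_norm_pi_le r : circle_norm (\pi_(circle R) r) <= `|r|.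
Proof.
rewrite circle_norm_pi; apply: ge_inf; last by exists 0; rewrite ?subr0.
by exists 0 => _ [m _ <-].
Qed.

Lemma circle_norm_small r :
  `|r| <= 2^-1 -> circle_norm (\pi_(circle R) r) = `|r|.
Proof.
move=> r_small; apply/eqP; rewrite eq_le circle_norm_pi_le circle_norm_pi.
apply: lb_le_inf; first by exists `|r - 0%:~R|, 0.
move=> _ [m _ <-]; have [->|m0] := eqVneq m 0; first by rewrite subr0.
(* A nonzero integer [m] gives |r - m| >= 1 - 1/2 >= |r|. *)
have m1 : 1 <= `|m%:~R : R| by rewrite -intr_norm ler1z -gtz0_ge1 normr_gt0.
have := lerB_dist (m%:~R : R) r; rewrite distrC; lra.
Qed.

(** Rounding to a nearest integer yields the representative; facts about the norm then reduce to
    facts about absolute values of reals. *)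
Lemma circle_norm_repr x :
  exists r, [/\ x = \pi_(circle R) r, circle_norm x = `|r| & `|r| <= 2^-1].
Proof.
pose s := repr x; pose m := Num.floor (s + 2^-1); exists (s - m%:~R).
have small : `|s - m%:~R| <= 2^-1.
  have := floor_le (s + 2^-1); have := floorD1_gt (s + 2^-1).
  rewrite -/m intrD ler_norml; lra.
have xE : x = \pi_(circle R) (s - m%:~R).
  rewrite -[LHS]reprK; apply/eqP; rewrite -Quotient.idealrBE.
  by apply/intrP; exists m; rewrite -/s; lra.
by rewrite {2}xE circle_norm_small.
Qed.

Lemma pi_circle0 : \pi_(circle R) 0 = 0.
Proof. exact: (raddf0 (\pi_(Quotient.quot (int_subgroup R)))). Qed.

Lemma pi_circleB r s :
  \pi_(circle R) r - \pi_(circle R) s = \pi_(circle R) (r - s).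
Proof. by rewrite (raddfB (\pi_(Quotient.quot (int_subgroup R)))). Qed.

Lemma pi_circleMn r n : \pi_(circle R) r *+ n = \pi_(circle R) (r *+ n).
Proof. by rewrite (raddfMn (\pi_(Quotient.quot (int_subgroup R)))). Qed.

Lemma circle_normB x y : circle_norm (x - y) <= circle_norm x + circle_norm y.
Proof.
have [r [-> -> _]] := circle_norm_repr x.
have [s [-> -> _]] := circle_norm_repr y.
rewrite pi_circleB; exact: le_trans (circle_norm_pi_le _) (ler_normB _ _).
Qed.

Lemma circle_norm_ge0 x : 0 <= circle_norm x.
Proof. by have [r [_ -> _]] := circle_norm_repr x. Qed.

Lemma circle_norm_le x : circle_norm x <= 2^-1.
Proof. by have [r [_ -> ]] := circle_norm_repr x. Qed.

Lemma circle_norm0 : circle_norm (0 : circle R) = 0.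
Proof. by rewrite -pi_circle0 circle_norm_small normr0 ?invr_ge0. Qed.

Lemma circle_norm_eq0 x : circle_norm x = 0 -> x = 0.
Proof.
have [r [-> -> _]] := circle_norm_repr x => /eqP; rewrite normr_eq0 => /eqP ->.
exact: pi_circle0.
Qed.

(** The multiple of a short representative is still short, so nothing wraps around the circle. *)
Lemma circle_normMn x n : circle_norm x *+ n <= 2^-1 ->
  circle_norm (x *+ n) = circle_norm x *+ n.
Proof.
have [r [-> -> _]] := circle_norm_repr x => small.
by rewrite pi_circleMn circle_norm_small normrMn.
Qed.

End CircleNorm.

(** * Counting the large multiples of a point *)

Section Multiples.
Variables (R : realType) (x : circle R) (b : nat).

(** Take the least [s] with s ||x|| >= 1/8. Either s = 1 or, by minimality, s ||x|| < 1/4, so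
    [x *+ s] does not wrap around. If s > 1, then (s - 1) ||x|| < 1/8 and b ||x|| >= 1/2 force 4 (s
    - 1) < b. *)
Lemma circle_norm_large_multiple : (1 < b)%N -> 2^-1 <= circle_norm x *+ b ->
  exists s, [/\ (0 < s)%N, (4 * s <= b + 3)%N & 8^-1 <= circle_norm (x *+ s)].
Proof.
move=> b_gt1 xb_large.
have t_ge0 := circle_norm_ge0 x; have t_le := circle_norm_le x.
have exs : exists s, 8^-1 <= circle_norm x *+ s.
  by exists b; apply: le_trans xb_large; lra.
have [s s_large smin] := ex_minnP exs.
have s_gt0 : (0 < s)%N.
  by case: s s_large {smin} => //; rewrite mulr0n; lra.
exists s; split=> //.
  have [->|s_neq1] := eqVneq s 1%N; first lia.
  have : circle_norm x *+ s.-1 < 8^-1.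
    by rewrite ltNge; apply/negP => /smin; lia.
  rewrite -ltnS ltnNge => lt_s1; apply/negP => le_bs.
  have : circle_norm x *+ b <= circle_norm x *+ (4 * s.-1).
    by apply: ler_wpMn2l => //; lia.
  rewrite mulnC mulrnA; lra.
rewrite circle_normMn //.
have [->//|s_neq1] := eqVneq s 1%N.
have : circle_norm x *+ s.-1 < 8^-1 by rewrite ltNge; apply/negP => /smin; lia.
have : circle_norm x < 8^-1.
  by rewrite ltNge; apply/negP => /(smin 1%N); lia.
have -> : circle_norm x *+ s = circle_norm x *+ s.-1 + circle_norm x.
  by rewrite -mulrSr prednK.
lra.
Qed.

(* If [x *+ s] is at distance [2 * e] from 0, then [x *+ r] and [x *+ (r + s)]
   cannot both be within [e] of 0. *)
Lemma card_large_multiples : (1 < b)%N -> 2^-1 <= circle_norm x *+ b ->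
  (b.-1 <= 4 * \sum_(1 <= r < b) (16^-1 <= circle_norm (x *+ r))%R)%N.
Proof.
move=> b_gt1 /(circle_norm_large_multiple b_gt1)[s [s_gt0 s_le xs_large]].
pose g r : nat := 16^-1 <= circle_norm (x *+ r).
have pair r : (1 <= g r + g (r + s))%N.
  rewrite /g; case: (leP (16^-1 : R)) => //= r_small.
  case: (leP (16^-1 : R)) => //= rs_small.
  have xsE : x *+ s = x *+ (r + s) - x *+ r by rewrite mulrnDr addrC addKr.
  have := circle_normB (x *+ (r + s)) (x *+ r); rewrite -xsE => xs_le.
  by suff: False by []; lra.
(* The index 0 contributes nothing, so the sum may start there. *)
have g0 : g 0%N = 0%N by rewrite /g mulr0n circle_norm0 lt_geF// invr_gt0.
have sumE : (\sum_(1 <= r < b) g r = \sum_(0 <= r < b) g r)%N.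
  by rewrite [RHS]big_ltn ?g0//; lia.
rewrite -/g sumE.
have le_sb : (s <= b)%N by lia.
(* Summing [pair] over r < b - s uses each index below [b] at most twice, so b - s is at most twice
   the full sum; 4 s <= b + 3 then gives the claim. *)
have : (b - s <= \sum_(0 <= r < b - s) g r + \sum_(s <= r < b) g r)%N.
  rewrite -[in X in (_ + X)%N](add0n s) big_addn -big_split /=.
  by rewrite -[X in (X <= _)%N](muln1) -{1}(subn0 (b - s)%N) -sum_nat_const_nat leq_sum.
have : (\sum_(0 <= r < b - s) g r <= \sum_(0 <= r < b) g r)%N.
  by rewrite [leqRHS](big_cat_nat (n := (b - s)%N)) ?leq_subr//= leq_addr.
have : (\sum_(s <= r < b) g r <= \sum_(0 <= r < b) g r)%N.
  by rewrite [leqRHS](big_cat_nat (n := s) (m := 0%N))//= leq_addl.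
lia.
Qed.

End Multiples.

(** * Upper density and comparison along blocks *)

Section UpperDensity.
Variable R : realType.
Implicit Types (A B : set nat) (v : R).

Lemma partial_densityE A n :
  partial_density R A n = (\sum_(0 <= i < n) (i \in A))%:R / n%:R.
Proof.
rewrite /partial_density -sum1_card big_mkcond big_mkord.
by congr (_%:R / _); apply: eq_bigr => i _; rewrite inE.
Qed.

Lemma sum_mem_le A n : (\sum_(0 <= i < n) (i \in A) <= n)%N.
Proof.
rewrite -[leqRHS]muln1 -{2}(subn0 n) -sum_nat_const_nat leq_sum// => i _.
exact: leq_b1.
Qed.

Lemma partial_density_bounds A n : 0 <= partial_density R A n <= 1.
Proof.
rewrite partial_densityE divr_ge0//=.
case: n => [|n]; first by rewrite invr0 mulr0.
by rewrite ler_pdivrMr ?ltr0n// mul1r ler_nat sum_mem_le.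
Qed.

Lemma partial_density_bounded A : bounded_fun (partial_density R A : _ -> R^o).
Proof.
exists 1; split=> // M ltM n _ /=.
by have /andP[d0 d1] := partial_density_bounds A n; rewrite ger0_norm//; lra.
Qed.

Lemma upper_density_lt A v : upper_density R A < v ->
  exists N, forall n, (N <= n)%N -> partial_density R A n < v.
Proof.
rewrite /upper_density (limn_supE (@partial_density_bounded A)) => /inf_lt[].
  by exists (sups (partial_density R A) 0), 0%N.
move=> _ [N _ <-] lt_v; exists N => n le_Nn; apply: le_lt_trans lt_v.
apply: ub_le_sup; last by exists n.
by exists 1 => _ [m _ <-]; case/andP: (partial_density_bounds A m).
Qed.

Lemma upper_density_le A v N :
  (forall n, (N <= n)%N -> partial_density R A n <= v) -> upper_density R A <= v.
Proof.
move=> le_v; rewrite /upper_density (limn_supE (@partial_density_bounded A)).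
apply: (@le_trans _ _ (sups (partial_density R A) N)).
  apply: ge_inf; last by exists N.
  exact/bounded_fun_has_lbound_sups/partial_density_bounded.
apply: ge_sup; first by exists (partial_density R A N), N => /=.
by move=> _ [n /= le_Nn <-]; exact: le_v.
Qed.

(* Inside a block the proportion of [A] is extremal at one of the two ends, so
   it suffices to compare [A] and [B] there. *)
Lemma upper_density_blocks A B (s : nat -> nat) (C : nat) :
  (forall k, (s k < s k.+1)%N) ->
  (forall k, (forall i, (s k <= i < s k.+1)%N -> i \in A) \/
             (forall i, (s k <= i < s k.+1)%N -> i \notin A)) ->
  (forall k, (\sum_(0 <= i < s k) (i \in A) <=
              C * \sum_(0 <= i < s k) (i \in B))%N) ->
  upper_density R B = 0 -> upper_density R A <= 0.
Proof.
move=> s_lt blocks le_count B0; apply/ler_addgt0Pr => e e_gt0; rewrite add0r.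
(* Needed for blocks inside [A]: removing the s_(k+1) - n last elements from the count must lower it
   by at least e (s_(k+1) - n). *)
wlog e_le1 : e e_gt0 / e <= 1.
  move=> wlog_e; have [/wlog_e|/ltW e_ge1] := leP e 1; first exact.
  by apply: le_trans e_ge1; apply: wlog_e.
(* Dividing by [C.+1] instead of [C] avoids a zero divisor. *)
have [N N_lt] : exists N, forall n, (N <= n)%N -> partial_density R B n < e / C.+1%:R.
  by apply: upper_density_lt; rewrite B0 divr_gt0.
have s_ge k : (k <= s k)%N.
  by elim: k => // k IHk; exact: leq_ltn_trans IHk (s_lt k).
have count_end k : (N <= k)%N -> (\sum_(0 <= i < s k) (i \in A))%:R <= e * (s k)%:R.
  move=> le_Nk; have := N_lt _ (leq_trans le_Nk (s_ge k)).
  have [->|sk0] := posnP (s k); first by rewrite big_geq// mulr0.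
  rewrite partial_densityE ltr_pdivrMr ?ltr0n// mulrAC ltr_pdivlMr ?ltr0n//.
  move=> /ltW; apply: le_trans; rewrite -natrM ler_nat.
  by apply: leq_trans (le_count k) _; rewrite mulnC leq_mul2l leqnSn orbT.
apply: (@upper_density_le _ _ (maxn 1 (s N))) => n.
rewrite geq_max => /andP[n_gt0 le_sNn].
rewrite partial_densityE ler_pdivrMr ?ltr0n//.
have [k le_Nk /andP[le_kn lt_nk]] : exists2 k, (N <= k)%N & (s k <= n < s k.+1)%N.
  have exk : exists k, (n < s k.+1)%N by exists n; exact: leq_trans (s_ge _).
  have [k lt_nk kmin] := ex_minnP exk.
  have s_mono := leq_mono (homo_ltn ltn_trans s_lt).
  exists k; first by rewrite -ltnS -(leqW_mono s_mono) (leq_ltn_trans le_sNn).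
  case: k kmin lt_nk => [|k] kmin lt_nk.
    apply/andP; split=> //.
    by apply: leq_trans le_sNn; rewrite s_mono.
  by rewrite lt_nk andbT leqNgt; apply/negP => /kmin; rewrite ltnn.
(* A block inside [A] is compared at its right end, a block disjoint from [A] at its left end. *)
have [blockA|blockA] := blocks k.
  have := count_end k.+1 (leqW le_Nk).
  rewrite (big_cat_nat (n := n)) ?(ltnW lt_nk)//=.
  rewrite [X in (_ + X)%N](eq_big_nat _ _ (F2 := fun=> 1%N)).
    rewrite sum_nat_const_nat muln1 -{2}(subnK (ltnW lt_nk)) !natrD.
    have : 0 <= (s k.+1 - n)%:R :> R by [].
    nra.
  by move=> i lt_i; rewrite blockA//; lia.
rewrite (big_cat_nat (n := s k))//= [X in (_ + X)%N](eq_big_nat _ _ (F2 := fun=> 0%N)).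
  rewrite big1_eq addn0; apply: le_trans (count_end k le_Nk) _.
  by rewrite ler_pM2l// ler_nat.
by move=> i lt_i; rewrite (negbTE (blockA _ _))//; lia.
Qed.

End UpperDensity.

(** * Block structure of the associated sequence *)

Section AssocSeq.
Variable a : nat -> nat.
Implicit Types (A : set nat) (i j k r : nat).
Hypothesis a_arith : arithmetic_seq a.
Local Open Scope nat_scope.

Lemma arithmetic_seq_le : {mono a : i j / i <= j}.
Proof.
by have [_ a_lt _] := a_arith; apply: leq_mono; exact: homo_ltn ltn_trans a_lt.
Qed.

Lemma arithmetic_seq_dvd i j : i <= j -> a i %| a j.
Proof.
have [_ _ a_dvd] := a_arith.
elim: j => [|j IHj]; first by rewrite leqn0 => /eqP ->.
by rewrite leq_eqVlt => /predU1P[->//|/IHj/dvdn_trans]; apply.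
Qed.

(** Elements q a_j with j >= k are multiples of a_k, and those with j < k lie below a_(j+1) <= a_k,
    so nothing falls strictly between r a_k and (r + 1) a_k. For r + 1 = b_(k+1) the successor is
    a_(k+1). *)
Lemma next_assoc_set k r : 1 <= r < Defs.ratio a k.+1 ->
  next_elt (assoc_set a) (r * a k) = (r.+1 * a k)%N.
Proof.
move=> /andP[r_gt0 r_lt]; have ak_gt0 : 0 < a k.
  exact: leq_ltn_trans (arithmetic_seq_gt k a_arith).
apply: next_eltE; last 2 first.
- by rewrite ltn_pmul2r.
- move=> _ [j [q [/andP[q_gt0 q_lt] ->]]] lt_t.
  have [le_kj|lt_jk] := leqP k j.
    have /dvdnP[c ajE] := arithmetic_seq_dvd le_kj.
    by move: lt_t; rewrite ajE mulnA ltn_pmul2r// leq_pmul2r.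
  have : q * a j < a k.
    apply: (@leq_trans (a j.+1)); last by rewrite arithmetic_seq_le.
    rewrite (ratioE j a_arith) ltn_pmul2r//.
    exact: leq_ltn_trans (arithmetic_seq_gt j a_arith).
  by have := leq_pmull (a k) r_gt0; lia.
have [lt_r1|le_r1] := ltnP r.+1 (Defs.ratio a k.+1); first by exists k, r.+1.
have -> : r.+1 = Defs.ratio a k.+1 by apply/eqP; rewrite eqn_leq le_r1 r_lt.
by rewrite -(ratioE k a_arith); exact: assoc_set_a.
Qed.

(** The range includes r = b_(k+1), one step past the block, which locates a_(k+1) and so determines
    n_(k+1). *)
Lemma assoc_seq_block k r : 1 <= r <= Defs.ratio a k.+1 ->
  assoc_seq a (assoc_index a k + r.-1) = r * a k.
Proof.
have [_ dE] := assoc_indexP k a_arith.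
case: r => // r; elim: r => [_|r IHr r_lt]; first by rewrite addn0 dE mul1n.
by rewrite addnS /assoc_seq /enumeration iterS [iter _ _ _]IHr ?next_assoc_set//; lia.
Qed.

Lemma assoc_index0 : assoc_index a 0 = 1.
Proof.
have [a0 _ _] := a_arith.
apply: assoc_indexE => //; rewrite a0; apply: next_eltE => //.
by exists 0, 1; rewrite a0 (ratio_ge2 0 a_arith).
Qed.

Lemma assoc_indexS k :
  assoc_index a k.+1 = assoc_index a k + (Defs.ratio a k.+1).-1.
Proof.
have [n_gt0 _] := assoc_indexP k a_arith; have b_ge2 := ratio_ge2 k a_arith.
apply: assoc_indexE => //; first lia.
by rewrite assoc_seq_block ?(ratioE k a_arith)//; lia.
Qed.

Lemma assoc_index_lt k : assoc_index a k < assoc_index a k.+1.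
Proof. by rewrite assoc_indexS; have := ratio_ge2 k a_arith; lia. Qed.

(** The blocks are disjoint because n_k is strictly increasing, so only the element k + 1 can put
    [i] into the lifting. *)
Lemma mem_lifting A k i : assoc_index a k <= i < assoc_index a k.+1 ->
  (i \in lifting a A) = (k.+1 \in A).
Proof.
have n_mono := leq_mono (homo_ltn ltn_trans assoc_index_lt).
move=> /andP[le_ki lt_ik]; apply/idP/idP; rewrite !inE; last first.
  by move=> Ak; exists k.+1; split=> //=; lia.
move=> [[|j] [Aj //= _ /andP[le_ji le_ij]]].
have n_gt0 : 0 < assoc_index a j.+1 by have := assoc_index_lt j; lia.
suff -> : k = j by [].
apply/eqP; rewrite eqn_leq -ltnS -(leqW_mono n_mono k j.+1).
rewrite -[j <= k]ltnS -(leqW_mono n_mono j k.+1).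
by lia.
Qed.

End AssocSeq.

(** * Members of the subgroup are torsion *)

Lemma infinite_nat_unbounded (A : set nat) :
  (forall N, exists2 n, (N <= n)%N & A n) -> infinite_set A.
Proof.
move=> A_unb /finite_seqP[s As].
have [n lt_n] := A_unb (\max_(i <- s) i).+1; rewrite As /= => n_s.
by rewrite ltnNge (@leq_bigmax_seq _ s xpredT (fun i : nat => i) n n_s) in lt_n.
Qed.

Section Torsion.
Variables (R : realType) (a : nat -> nat) (x : circle R).

(** Indexed by the ratio b_k, to match [lifting], where [k] stands for the block from n_(k-1) to n_k
    - 1. *)
Definition expanding_blocks : set nat :=
  [set k | (1 <= k)%N /\ 2^-1 <= circle_norm (x *+ a k.-1) *+ Defs.ratio a k].

(** The exceptional set of [stat_cvg0] for e = 1/16, hence of density zero when [x] is in the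
    subgroup. *)
Definition large_indices : set nat :=
  [set n | (1 <= n)%N /\ 16^-1 <= circle_norm (x *~ (assoc_seq a n)%:Z)].

Hypothesis a_arith : arithmetic_seq a.

(* Off [expanding_blocks], passing from [a_k x] to [a_(k+1) x] multiplies the norm
   by the ratio, so it would grow without bound if this set were finite. *)
Lemma infinite_expanding_blocks :
  (forall k, x *+ a k != 0) -> infinite_set expanding_blocks.
Proof.
move=> xa_neq0; apply: infinite_nat_unbounded => N; apply: contrapT => not_ex.
have small k : (N <= k)%N -> circle_norm (x *+ a k) *+ Defs.ratio a k.+1 < 2^-1.
  move=> le_Nk; rewrite ltNge; apply/negP => large; apply: not_ex.
  by exists k.+1; [exact: leqW|split].
(* The norm at least doubles at each step, but linear growth already contradicts the bound 1/2. *)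
have grow j : circle_norm (x *+ a N) *+ j.+1 <= circle_norm (x *+ a (N + j)%N).
  elim: j => [|j IHj]; first by rewrite addn0.
  have lt_half := small (N + j)%N (leq_addr _ _).
  rewrite addnS (ratioE _ a_arith) mulnC mulrnA.
  rewrite [leRHS]circle_normMn ?(ltW lt_half)//.
  apply: (@le_trans _ _ (circle_norm (x *+ a (N + j)%N) *+ 2)).
    rewrite mulrSr mulr2n lerD//; apply: le_trans IHj.
    by rewrite -[leLHS]mulr1n; apply: ler_wpMn2l; first exact: circle_norm_ge0.
  by apply: ler_wpMn2l; [exact: circle_norm_ge0|exact: ratio_ge2].
have t_gt0 : 0 < circle_norm (x *+ a N).
  rewrite lt_neqAle circle_norm_ge0 andbT eq_sym.
  by apply/eqP => /circle_norm_eq0/eqP; apply/negP.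
have := archi_boundP (ltW (divr_gt0 ltr01 t_gt0)).
set M := Num.bound _; rewrite ltr_pdivrMr// mulr_natl => M_gt.
have : circle_norm (x *+ a N) *+ M <= 2^-1.
  apply: le_trans (circle_norm_le (x *+ a (N + M)%N)).
  by apply: le_trans (grow M); apply: ler_wpMn2l (leqnSn M); exact: circle_norm_ge0.
by apply/negP; rewrite -ltNge; apply: lt_trans M_gt; rewrite invf_lt1 ?ltr1n.
Qed.

(** Block by block: an expanding block adds b_(k+1) - 1 indices to the lifting, and at least a
    quarter of them are large by [card_large_multiples]; any other block adds none to the
    lifting. *)
Lemma count_lifting_le k :
  (\sum_(0 <= i < assoc_index a k) (i \in lifting a expanding_blocks) <=
   4 * \sum_(0 <= i < assoc_index a k) (i \in large_indices))%N.
Proof.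
elim: k => [|k IHk].
  (* Since n_0 = 1, only the index 0 is counted, and every block starts at a positive index. *)
  rewrite assoc_index0// !big_nat1 [0%N \in _](_ : _ = false) //.
  apply/negbTE; rewrite notin_setE => -[j [_ _ /andP[+ _]]].
  by case: (assoc_indexP j.-1 a_arith); lia.
have [n_gt0 _] := assoc_indexP k a_arith; have b_ge2 := ratio_ge2 k a_arith.
have le_n := ltnW (assoc_index_lt a_arith k).
rewrite !(big_cat_nat (m := 0%N) (n := assoc_index a k) (p := assoc_index a k.+1))//=.
rewrite mulnDr leq_add//.
rewrite (eq_big_nat _ _ (F2 := fun=> (k.+1 \in expanding_blocks) : nat)); last first.
  by move=> i lt_i; rewrite (mem_lifting a_arith _ lt_i).
rewrite sum_nat_const_nat (assoc_indexS a_arith) addKn.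
case: (boolP (k.+1 \in expanding_blocks)) => [|_]; last by rewrite muln0.
rewrite inE => -[_ /= large]; rewrite muln1.
apply: leq_trans (card_large_multiples b_ge2 large) _; rewrite leq_mul2l/=.
(* Both sums are reindexed from 0: position n_k + r carries (r + 1) a_k. *)
rewrite -[X in (_ <= \sum_(X <= _ < _) _)%N]add0n big_addn addKn big_add1.
rewrite !big_nat leq_sum// => r lt_r.
case: leP => //= large_r; rewrite lt0b inE; split; first lia.
rewrite addnC -pmulrn (@assoc_seq_block _ a_arith k r.+1); last lia.
by rewrite mulnC mulrnA.
Qed.

Lemma stat_char_torsion : strongly_non_dli R a ->
  stat_char_subgroup R (fun n => (assoc_seq a n)%:Z) x -> exists k, x *+ a k = 0.
Proof.
move=> sndli x_stat; apply: contrapT => xa_neq0.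
have blocks_inf : infinite_set expanding_blocks.
  by apply: infinite_expanding_blocks => k; apply/eqP => xa0; apply: xa_neq0; exists k.
have := sndli expanding_blocks (fun k => @proj1 _ _) blocks_inf.
apply/negP; rewrite -leNgt.
have [B0 _] : has_density large_indices (0 : R) by apply: x_stat; rewrite invr_gt0.
apply: (upper_density_blocks (assoc_index_lt a_arith) _ count_lifting_le B0) => k.
case: (boolP (k.+1 \in expanding_blocks)) => k_in; [left|right] => i lt_i.
  by rewrite (mem_lifting a_arith _ lt_i).
by rewrite (mem_lifting a_arith _ lt_i).
Qed.

End Torsion.

(** * Countability, from the rationality of torsion points *)

Lemma circle_torsion_rational (R : realType) (x : circle R) (n : nat) :
  (0 < n)%N -> x *+ n = 0 -> exists q : rat, x = \pi_(circle R) (ratr q).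
Proof.
move=> n_gt0; have [r [-> _ _]] := circle_norm_repr x.
rewrite pi_circleMn -pi_circle0 => /eqP; rewrite -Quotient.idealrBE subr0.
move=> /intrP[m rnE]; exists (m%:~R / n%:R); congr (\pi_(circle R) _).
rewrite fmorph_div /= ratr_int ratr_nat -rnE -(mulr_natr r n) mulfK//.
by rewrite pnatr_eq0 -lt0n.
Qed.

Theorem corollary3p18 (R : realType) (a : nat -> nat)
    (a_arith : arithmetic_seq a) (a_sndli : strongly_non_dli R a) :
  countable (stat_char_subgroup R (fun n => (assoc_seq a n)%:Z%R)).
Proof.
apply: (@sub_countable _ _ _ (range (fun q : rat => \pi_(circle R) (ratr q)))).
  apply: subset_card_le => x /(stat_char_torsion a_arith a_sndli)[k xa0].
  have [|q ->] := circle_torsion_rational _ xa0; last by exists q.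
  exact: leq_ltn_trans (arithmetic_seq_gt k a_arith).
apply: sub_countable (card_image_le _ _) _; exact: countableP.
Qed.
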